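(* Every uniformly convex real Banach space $X$ has the local directional Bishop-Phelps-Bollob\'as property for Lipschitz functionals. That is, for every $\varepsilon>0$ there is a $\delta>0$ such that for every $f\in\mathrm{Lip}_0(X)$ with $\|f\|=1$ and for every $x,y\in X$ with $x\neq y$ satisfying $\frac{f(x)-f(y)}{\|x-y\|}>1-\delta$, there are $g\in\mathrm{Lip}_0(X)$ with $\|g\|=1$, $v\in X$ and $u\in S_X$ such that $g$ attains its norm in the point $v$ at the direction $u$, $\|g-f\|<\varepsilon$, $\left\|\frac{x-y}{\|x-y\|}-u\right\|<\varepsilon$, and $\mathrm{dist}(v,\mathrm{conv}\{x,y\})<\varepsilon$.
   Context: $S_X$ and $B_X$ denote the unit sphere and closed unit ball of $X$. $\mathrm{Lip}_0(X)$ is the Banach space of all Lipschitz functions $f:X\to\mathbb{R}$ with $f(0)=0$, with norm $\|f\|=\sup\left\{\frac{|f(x)-f(y)|}{\|x-y\|}: x,y\in X,\ x\neq y\right\}$. A functional $g\in\mathrm{Lip}_0(X)$ attains its norm in a point $v\in X$ at the direction $u\in S_X$ if there is a sequence of pairs $\{(x_n,y_n)\}$ in $X\times X$, with $x_n\neq y_n$, such that $\lim_n x_n=\lim_n y_n=v$, $\lim_n\frac{x_n-y_n}{\|x_n-y_n\|}=u$, and $\lim_n\frac{g(x_n)-g(y_n)}{\|x_n-y_n\|}=\|g\|$. A Banach space $X$ is uniformly convex if for every $\varepsilon>0$ there is $\delta>0$ such that for all $x,y\in B_X$, $\|x-y\|\geq\varepsilon$ implies $\left\|\frac{x+y}{2}\right\|\leq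 1-\delta$. $\mathrm{conv}\{x,y\}$ is the closed segment joining $x$ and $y$, and $\mathrm{dist}$ is the norm distance. *)

(* Defs.v *)
From HB Require Import structures.
From mathcomp Require Import all_boot all_order all_algebra.
From mathcomp Require Import all_classical all_reals all_analysis.

Set Implicit Arguments.
Unset Strict Implicit.
Unset Printing Implicit Defensive.

Import Order.TTheory GRing.Theory Num.Theory.
Import numFieldNormedType.Exports.

Local Open Scope classical_set_scope.
Local Open Scope ring_scope.

Section Definitions.
Context {R : realType} {X : normedModType R}.
Implicit Types (f g : X -> R) (x y u v : X) (A : set X).

Definition unit_sphere : set X := [set x | `|x| = 1].

Definition unit_ball : set X := [set x | `|x| <= 1].

Definition segment x y : set X :=
  [set t *: x + (1 - t) *: y | t in `[0, 1]%classic].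

(* [inf] is the real infimum, which is 0 on the empty set: only meaningful
   for nonempty [A]. *)
Definition dist v A : R := inf [set `|v - a| | a in A].

Definition direction x y : X := `|x - y|^-1 *: (x - y).

Definition Lip0 : set (X -> R) := [set f | lipschitz f /\ f 0 = 0].

Definition slope f x y : R := (f x - f y) / `|x - y|.

(* [sup] is the real supremum, with value 0 on unbounded sets, so this is the
   norm of [Lip0] only for [f] in [Lip0].  If [X] is the zero space, the set is
   empty and the value 0 is the right one. *)
Definition lip_norm f : R :=
  sup [set r | exists x y, x != y /\ r = `|f x - f y| / `|x - y|].

Definition attains_norm_at_direction g v u : Prop :=
  exists a b : nat -> X,
    [/\ forall n, a n != b n,
        a n @[n --> \oo] --> v /\ b n @[n --> \oo] --> v,
        direction (a n) (b n) @[n --> \oo] --> u &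
        slope g (a n) (b n) @[n --> \oo] --> lip_norm g].

End Definitions.

Arguments unit_sphere {R} X.
Arguments unit_ball {R} X.
Arguments Lip0 {R} X.

Definition uniformly_convex {R : realType} (X : normedModType R) : Prop :=
  forall e : R, 0 < e -> exists2 d : R, 0 < d &
    forall x y : X, unit_ball X x -> unit_ball X y ->
      e <= `|x - y| -> `|2^-1 *: (x + y)| <= 1 - d.

Definition local_directional_BPB {R : realType} (X : normedModType R) : Prop :=
  forall e : R, 0 < e -> exists2 d : R, 0 < d &
    forall f : X -> R, Lip0 X f -> lip_norm f = 1 ->
    forall x y : X, x != y -> 1 - d < slope f x y ->
    exists (g : X -> R) (v u : X),
      [/\ Lip0 X g /\ lip_norm g = 1,
          unit_sphere X u /\ attains_norm_at_direction g v u,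
          lip_norm (g - f) < e,
          `|direction x y - u| < e &
          dist v (segment x y) < e].

(* Main.v *)
(* Suppose the slope of f at (x, y) is almost |f|.  Adding a small multiple of a
   bump h of Lipschitz constant 1, supported near [x, y] and of slope 1 at
   (x, y), raises the norm by almost the full multiple, so every nearly optimal
   pair of the new function has h-slope almost 1.  The bump is the minimum of
   two cones, one with a very far vertex in the direction u of x - y, the other
   of slope 1/2; a slope almost 1 can only come from the first, so by uniform
   convexity the pair has direction close to u, and it lies near [x, y].  Such a
   pair can be subdivided, hence taken as short as wanted.  Iterating with
   geometrically small multiples gives functions, points and directions that
   converge to g, v and u; finally g is normalised. *)
Require Import Defs.
From mathcomp Require Import all_boot all_order all_algebra.
From mathcomp Require Import all_classical all_reals all_analysis.
From mathcomp Require Import ring lra.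

Set Implicit Arguments.
Unset Strict Implicit.
Unset Printing Implicit Defensive.

Import Order.TTheory GRing.Theory Num.Theory.
Import numFieldNormedType.Exports.

Local Open Scope classical_set_scope.
Local Open Scope ring_scope.

(** * The Lipschitz norm through explicit Lipschitz constants *)

Section LipschitzNorm.
Context {R : realType} {X : normedModType R}.
Implicit Types (f g : X -> R) (x y p q : X) (k : R).

(** [lip_norm] is a genuine supremum only for Lipschitz functions, so a constant [k] is carried
    along as the witness of boundedness. *)
Definition lip_bound k f := forall x y, `|f x - f y| <= k * `|x - y|.

Lemma dist_gt0 x y : x != y -> 0 < `|x - y|.
Proof. by move=> xy; rewrite normr_gt0 subr_eq0. Qed.

Lemma lipschitzP f : lipschitz f <-> exists k, lip_bound k f.
Proof.
split=> [[k0 [_ kf]]|[k kf]].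
  by exists (k0 + 1) => x y; apply: (kf (k0 + 1) _ (x, y)); rewrite ?ltrDl.
exists k; split; first exact: num_real.
move=> M kM [x y] _ /=; apply: (le_trans (kf x y)).
by rewrite ler_wpM2r // ltW.
Qed.

Lemma lip_norm_ubound k f : lip_bound k f ->
  ubound [set r | exists x y, x != y /\ r = `|f x - f y| / `|x - y|] k.
Proof.
by move=> kf _ [x [y [xy ->]]]; rewrite ler_pdivrMr ?dist_gt0.
Qed.

Lemma lip_norm_le k f : 0 <= k -> lip_bound k f -> lip_norm f <= k.
Proof.
move=> k0 /lip_norm_ubound kf; rewrite /lip_norm; set A := (X in sup X).
have [->|/set0P A0] := eqVneq A set0; first by rewrite sup0.
exact: ge_sup.
Qed.

Lemma lip_norm_bound k f : lip_bound k f -> lip_bound (lip_norm f) f.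
Proof.
move=> kf x y; have [->|xy] := eqVneq x y.
  by rewrite !subrr !normr0 mulr0.
rewrite -ler_pdivrMr ?dist_gt0 //; apply: ub_le_sup; last by exists x, y.
by exists k; apply: lip_norm_ubound.
Qed.

Lemma slope_le_lip_norm k f x y : lip_bound k f -> x != y ->
  slope f x y <= lip_norm f.
Proof.
move=> /lip_norm_bound kf xy; rewrite /slope ler_pdivrMr ?dist_gt0 //.
exact: le_trans (ler_norm _) (kf _ _).
Qed.

Lemma lip_norm_adherent k f x y d : lip_bound k f -> x != y -> 0 < d ->
  exists p q, p != q /\ lip_norm f - d < slope f p q.
Proof.
move=> kf xy d0.
set A := [set r | exists x y, x != y /\ r = `|f x - f y| / `|x - y|].
have supA : has_sup A.
  split; first by exists (`|f x - f y| / `|x - y|), x, y.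
  by exists k; apply: lip_norm_ubound.
have [_ [p [q [pq ->]]] fpq] := sup_adherent d0 supA.
(* The supremum runs over absolute values; swapping the pair if necessary turns the quotient into a
   signed slope. *)
have [fqp|fpq'] := leP (f q) (f p).
  by exists p, q; split=> //; rewrite /slope -[f p - f q]ger0_norm // subr_ge0.
exists q, p; split; first by rewrite eq_sym.
by rewrite /slope -[f q - f p]gtr0_norm ?subr_gt0 // distrC [`|q - p|]distrC.
Qed.

Lemma lip_boundD k l f g : lip_bound k f -> lip_bound l g ->
  lip_bound (k + l) (f + g).
Proof.
move=> kf lg x y; rewrite /= opprD addrACA mulrDl.
by apply: (le_trans (ler_normD _ _)); apply: lerD.
Qed.

Lemma lip_boundZ k a f : lip_bound k f ->
  lip_bound (`|a| * k) (fun z => a * f z).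
Proof. by move=> kf x y; rewrite -mulrBr normrM -mulrA ler_wpM2l. Qed.

Lemma lip_boundN k f g : lip_bound k (f - g) -> lip_bound k (g - f).
Proof.
move=> kfg x y; have := kfg x y; rewrite !fctE.
suff -> : g x - f x - (g y - f y) = - (f x - g x - (f y - g y)).
  by rewrite normrN.
by ring.
Qed.

Lemma lip_norm_leB k l f g : 0 <= k -> 0 <= l ->
  lip_bound k f -> lip_bound l (g - f) ->
  lip_norm g <= lip_norm f + l.
Proof.
move=> k0 l0 /lip_norm_bound kf lgf.
have [[x [y xy]]|no] := pselect (exists x y : X, x != y); last first.
  (* In the zero space the set of quotients is empty and [lip_norm f] is the value 0 of [sup] on
     it. *)
  apply: lip_norm_le => [|x y].
    rewrite addr_ge0 // /lip_norm; set A := (X in sup X).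
    suff -> : A = set0 by rewrite sup0.
    by rewrite -subset0 => r [x [y [xy _]]]; apply: no; exists x, y.
  have [->|xy] := eqVneq x y; first by rewrite !subrr !normr0 mulr0.
  by exfalso; apply: no; exists x, y.
apply: lip_norm_le.
  rewrite addr_ge0 // -(pmulr_lge0 _ (dist_gt0 xy)).
  exact: le_trans (kf x y).
have -> : g = f + (g - f) by apply/funext => z; rewrite !fctE addrC subrK.
exact: lip_boundD.
Qed.

Lemma direction_norm x y : x != y -> `|direction x y| = 1.
Proof.
move=> xy; rewrite normrZ normfV normr_id mulVf // gt_eqF //.
exact: dist_gt0.
Qed.

Lemma scale_direction x y : x != y -> `|x - y| *: direction x y = x - y.
Proof. by move=> xy; rewrite scalerA divff ?scale1r // gt_eqF ?dist_gt0. Qed.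

End LipschitzNorm.

(** * Shortening a pair without losing slope *)

Section Subdivision.
Context {R : realType} {X : normedModType R}.
Implicit Types (f : X -> R) (p q : X) (a b t : R).

(** The mean slope over an interval is the average of those over its two halves, so one half does at
    least as well; bisection repeats this. *)
Lemma bisect_slope (F : R -> R) n : exists a b,
  [/\ 0 <= a, b <= 1, b - a = 2^-1 ^+ n & (F 1 - F 0) * (b - a) <= F b - F a].
Proof.
elim: n => [|n [a [b [a0 b1 ab Fab]]]].
  by exists 0, 1; rewrite subr0 mulr1.
have ab0 : 0 < b - a by rewrite ab exprn_gt0.
pose m := (a + b) / 2.
have [Fm|Fm] := leP ((F 1 - F 0) * (m - a)) (F m - F a).
  exists a, m; split=> //; first by rewrite /m; lra.
  by rewrite exprSr -ab /m; field.
exists m, b; split=> //; first by rewrite /m; lra.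
  by rewrite exprSr -ab /m; field.
have -> : (F 1 - F 0) * (b - m) = (F 1 - F 0) * (b - a) - (F 1 - F 0) * (m - a).
  by rewrite /m; field.
lra.
Qed.

Lemma half_expn_lt (C d : R) : 0 < d ->
  exists N, forall n, (N <= n)%N -> C * 2^-1 ^+ n < d.
Proof.
move=> d0.
have /cvgr_dist_lt/(_ d d0)[N _ CN] : geometric C (2^-1 : R) @ \oo --> 0.
  by apply: cvg_geometric; rewrite ger0_norm // invf_lt1 // ltr1n.
exists N => n /CN; rewrite /= sub0r normrN.
by apply: le_lt_trans; rewrite ler_norm.
Qed.

(** Bisection of [f] along the segment: subintervals of a segment all have its direction. *)
Lemma shrink_pair f p q r : p != q -> 0 < r -> exists p' q',
  [/\ segment p q p', p' != q', `|p' - q'| < r,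
      direction p' q' = direction p q & slope f p q <= slope f p' q'].
Proof.
move=> pq r0; have [N /(_ _ (leqnn N)) Nr] := half_expn_lt `|p - q| r0.
pose l t := t *: p + (1 - t) *: q.
have [a [b [a0 b1 ab Fab]]] := bisect_slope (f \o l) N.
have ab0 : 0 < b - a by rewrite ab exprn_gt0.
have lE s t : l s - l t = (s - t) *: (p - q).
  rewrite /l opprD addrACA -!scalerBl scalerBr -scaleNr.
  by congr (_ + _ *: _); ring.
have l1 : l 1 = p by rewrite /l scale1r subrr scale0r addr0.
have l0 : l 0 = q by rewrite /l scale0r subr0 scale1r add0r.
have nE : `|l b - l a| = (b - a) * `|p - q| by rewrite lE normrZ gtr0_norm.
have pq0 := dist_gt0 pq.
exists (l b), (l a); split.
- by exists b => //=; rewrite in_itv /= b1 andbT; lra.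
- by rewrite -subr_eq0 -normr_eq0 nE gt_eqF // mulr_gt0.
- by rewrite nE ab mulrC.
- rewrite /direction nE lE scalerA; congr (_ *: _).
  by field; rewrite !gt_eqF.
- rewrite /slope nE ler_pdivlMr ?mulr_gt0 //.
  have -> : (f p - f q) / `|p - q| * ((b - a) * `|p - q|) =
      (f p - f q) * (b - a).
    by field; rewrite gt_eqF.
  by move: Fab => /=; rewrite l1 l0.
Qed.

End Subdivision.

(** * Cones, their steep directions, and the bump *)

Section Bump.
Context {R : realType} {X : normedModType R}.
Implicit Types (c x y z p q u : X) (s T : R).

(* Since [uc] bounds the midpoint, [(L + t) a = (c - p) + t (a + w)] with
   [L = |c - q|], [t = |p - q|] and [a], [w] the two directions forces [a] and
   [w] to be close; this replaces the norming functional of [a]. *)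
Lemma cone_slope_direction (e d : R) c p q :
  (forall x y : X, unit_ball X x -> unit_ball X y ->
     e <= `|x - y| -> `|2^-1 *: (x + y)| <= 1 - d) ->
  0 < d -> p != q -> c != q ->
  (1 - d) * `|p - q| < `|c - q| - `|c - p| ->
  `|direction c q - direction p q| < e.
Proof.
move=> uc d0 pq cq sl; rewrite ltNge; apply/negP => eaw.
have := uc (direction c q) (direction p q).
rewrite /unit_ball /= !direction_norm // => /(_ (lexx _) (lexx _) eaw).
rewrite normrZ gtr0_norm ?invr_gt0 // => mid.
have t0 := dist_gt0 pq; have L0 := dist_gt0 cq.
have E : (`|c - q| + `|p - q|) *: direction c q =
    (c - p) + `|p - q| *: (direction c q + direction p q).
  rewrite scalerDl scalerDr !scale_direction // [RHS]addrCA.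
  by rewrite [c - p + _]addrA subrK addrC.
have := congr1 Num.norm E; rewrite normrZ direction_norm // mulr1.
rewrite gtr0_norm ?addr_gt0 // => E2.
have := ler_normD (c - p) (`|p - q| *: (direction c q + direction p q)).
rewrite -E2 normrZ gtr0_norm // => tri.
have : `|p - q| * `|direction c q + direction p q| <= `|p - q| * (2 * (1 - d)).
  by rewrite ler_pM2l //; lra.
have : 0 < d * `|p - q| by rewrite mulr_gt0.
move: sl tri; rewrite mulrBl mul1r mulrBr mulr1 mulrBr; lra.
Qed.

(** A far vertex is seen from every point near [y] in almost the direction [u]: with [c] the vertex,
    [c - q] differs from [|c - q| u] by [(T - |c - q|) u - (q - y)], and both terms have norm at
    most [|q - y|]. *)
Lemma cone_direction T u y q : 0 <= T -> `|u| = 1 -> y + T *: u != q ->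
  `|y + T *: u - q| * `|direction (y + T *: u) q - u| <= 2 * `|q - y|.
Proof.
move=> T0 u1 cq; set c := y + _ in cq *.
have L0 := dist_gt0 cq.
rewrite -[X in X * _](gtr0_norm L0) -normrZ scalerBr scale_direction //.
have cqE : c - q = T *: u - (q - y) by rewrite /c opprB addrA [T *: u + y]addrC.
have -> : c - q - `|c - q| *: u = (T - `|c - q|) *: u - (q - y).
  by rewrite scalerBl {1}cqE addrAC.
apply: (le_trans (ler_normB _ _)); rewrite normrZ u1 mulr1.
have -> : 2 * `|q - y| = `|q - y| + `|q - y| by ring.
rewrite lerD2r.
have -> : T = `|T *: u| by rewrite normrZ u1 mulr1 ger0_norm.
apply: (le_trans (ler_dist_dist _ _)).
by rewrite cqE opprB addrCA subrr addr0.
Qed.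

(** In use [c] is [y + T *: u], so the first cone grows from 0 at [y] to [s] at [y + s *: u]; the
    second is positive exactly within distance [4 * s] of [y]. *)
Definition bump T s c y z : R :=
  Num.max 0 (Num.min (T - `|c - z|) (2 * s - `|z - y| / 2)).

Lemma minr_dist_le (k a b a' b' : R) : `|a - a'| <= k -> `|b - b'| <= k ->
  `|Num.min a b - Num.min a' b'| <= k.
Proof.
rewrite !ler_norml => /andP[? ?] /andP[? ?].
by case: (leP a b) => ?; case: (leP a' b') => ?; apply/andP; split; lra.
Qed.

Lemma maxr_dist_le (k a b a' b' : R) : `|a - a'| <= k -> `|b - b'| <= k ->
  `|Num.max a b - Num.max a' b'| <= k.
Proof.
rewrite !ler_norml => /andP[? ?] /andP[? ?].
by case: (leP a b) => ?; case: (leP a' b') => ?; apply/andP; split; lra.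
Qed.

Lemma bump_lip T s c y : lip_bound 1 (bump T s c y).
Proof.
move=> p q; rewrite mul1r; apply: maxr_dist_le; first by rewrite subrr normr0.
have h1 : `| `|c - p| - `|c - q| | <= `|p - q|.
  apply: (le_trans (ler_dist_dist _ _)).
  by rewrite opprB addrC addrA subrK distrC.
have h2 : `| `|p - y| - `|q - y| | <= `|p - q|.
  apply: (le_trans (ler_dist_dist _ _)).
  by rewrite opprB addrA subrK.
have ? := normr_ge0 (p - q).
rewrite ler_norml in h1; rewrite ler_norml in h2.
case/andP: h1 => ? ?; case/andP: h2 => ? ?.
by apply: minr_dist_le; rewrite ler_norml; apply/andP; split; lra.
Qed.

(* The second cone has slope at most 1/2, so only the first one can produce a
   larger slope, and only inside the support of the bump. *)
Lemma bump_slope T s c y p q :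
  2^-1 * `|p - q| < bump T s c y p - bump T s c y q ->
  bump T s c y p - bump T s c y q <= `|c - q| - `|c - p| /\
  `|p - y| <= 4 * s.
Proof.
have : `| `|p - y| - `|q - y| | <= `|p - q|.
  apply: (le_trans (ler_dist_dist _ _)).
  by rewrite opprB addrA subrK.
have := normr_ge0 (p - q); rewrite ler_norml /bump => ? /andP[? ?].
case: (leP 0 (Num.min _ (2 * s - `|p - y| / 2)));
case: (leP 0 (Num.min _ (2 * s - `|q - y| / 2)));
by case: (leP (T - `|c - p|)) => ?; case: (leP (T - `|c - q|)) => ? ? ? ?;
  split; lra.
Qed.

Lemma bump_center s T u y : 0 <= s -> 0 <= T -> `|u| = 1 ->
  bump T s (y + T *: u) y y = 0.
Proof.
move=> s0 T0 u1; rewrite /bump addrAC subrr add0r normrZ u1 mulr1 ger0_norm //.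
rewrite !subrr normr0 mul0r subr0 min_l ?maxxx //; lra.
Qed.

Lemma bump_tip s T u y : 0 <= s -> s <= T -> `|u| = 1 ->
  bump T s (y + T *: u) y (y + s *: u) = s.
Proof.
move=> s0 sT u1; have T0 := le_trans s0 sT.
have -> : bump T s (y + T *: u) y (y + s *: u) =
    Num.max 0 (Num.min (T - (T - s)) (2 * s - s / 2)).
  rewrite /bump opprD addrACA subrr add0r -scalerBl normrZ u1 mulr1.
  rewrite ger0_norm ?subr_ge0 // [y + _]addrC addrK normrZ u1 mulr1.
  by rewrite ger0_norm.
(* At the tip the second cone has height [3 s / 2], above the height [s] of the first. *)
rewrite opprB addrCA subrr addr0 min_l; first by rewrite max_r.
lra.
Qed.

End Bump.

(** * One perturbation step *)

Section Perturbation.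
Context {R : realType} {X : normedModType R}.
Implicit Types (f g : X -> R) (x y p q u : X).

Lemma slopeD f g x y : slope (f + g) x y = slope f x y + slope g x y.
Proof. by rewrite /slope -mulrDl; congr (_ / _); rewrite !fctE; ring. Qed.

(** The tolerance [d] is chosen before [f], which makes the final [d] uniform; [d'] and [r] are
    free, so the new pair can meet whatever the next step demands. *)
Lemma perturbation (eta : R) : uniformly_convex X -> 0 < eta ->
  exists d : R, [/\ 0 < d, d <= eta &
    forall f k, 0 <= k -> lip_bound k f -> forall x y, x != y ->
      lip_norm f - d < slope f x y ->
      forall d' r : R, 0 < d' -> 0 < r -> exists f' x' y',
      [/\ f' 0 = f 0, lip_bound eta (f' - f),
          x' != y' /\ `|x' - y'| < r, lip_norm f' - d' < slope f' x' y' &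
          `|direction x' y' - direction x y| <= eta /\
          `|x' - x| <= 5 * `|x - y|]].
Proof.
move=> ucX eta0; have [d0 d00 uc] := ucX _ (divr_gt0 eta0 (ltr0n _ 2)).
(* A bump slope above [1 - m] serves both [uc], as [m <= d0], and [bump_slope], as
   [1 - m >= 1/2]. *)
pose m := Num.min d0 2^-1.
have m0 : 0 < m by rewrite lt_min d00 invr_gt0 /=.
have md : m <= d0 by rewrite ge_min lexx.
have m2 : m <= 2^-1 by rewrite ge_min lexx orbT.
have etam : 0 < eta * m by rewrite mulr_gt0.
exists (eta * m / 2); split.
- by rewrite divr_gt0.
- by have : eta * m <= eta * 2^-1; [rewrite ler_pM2l|lra].
move=> f k k0 kf x y xy fxy d' r d'0 r0.
pose s := `|x - y|; have s0 : 0 < s := dist_gt0 xy.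
pose u := direction x y; have u1 : `|u| = 1 by apply: direction_norm.
have xE : x = y + s *: u by rewrite /s /u scale_direction // addrC subrK.
(* The new [q] will satisfy [|q - y| <= 5 s], hence [|c - q| >= T - 5 s = 20 s / eta], and
   [cone_direction] then gives an error of at most [eta / 2]. *)
pose T := 5 * s * (1 + 4 / eta).
have eta40 : 0 < s / eta by rewrite divr_gt0.
have TE : T = 5 * s + 20 * (s / eta) by rewrite /T; field; rewrite gt_eqF.
have sT : s <= T by rewrite TE; lra.
have T0 : 0 < T by lra.
pose c := y + T *: u.
pose b := bump T s c y.
(* Subtracting [b 0] keeps the value at the origin unchanged. *)
pose h : X -> R := fun z => eta * (b z - b 0).
have hlip : lip_bound eta h.
  move=> p q; rewrite /h -mulrBr normrM gtr0_norm // ler_pM2l //.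
  have -> : b p - b 0 - (b q - b 0) = b p - b q by ring.
  by have := bump_lip T s c y p q; rewrite mul1r.
have hf : lip_bound eta (f + h - f).
  move=> p q; have := hlip p q.
  by rewrite !fctE addrAC subrr add0r addrAC subrr add0r.
have f'lip := lip_boundD kf hlip.
pose f' := f + h.
have hxy : slope h x y = eta.
  rewrite /slope /h /b /c [in bump _ _ _ _ x]xE.
  rewrite (bump_tip _ (ltW s0) sT u1) (bump_center _ (ltW s0) (ltW T0) u1).
  by rewrite -/s; field; rewrite gt_eqF.
have dm0 : 0 < Num.min (eta * m / 2) d' by rewrite lt_min d'0 divr_gt0.
have [p0 [q0 [pq0 fpq0]]] := lip_norm_adherent f'lip xy dm0.
(* Length below [s] puts [q] within [5 s] of [y] once [p] is within [4 s]. *)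
have rs0 : 0 < Num.min r s by rewrite lt_min r0.
have [p [q [_ pq + _ fpq]]] := shrink_pair f' pq0 rs0.
rewrite lt_min => /andP[pqr pqs].
have {fpq0 fpq} fpq := lt_le_trans fpq0 fpq.
have md1 : Num.min (eta * m / 2) d' <= eta * m / 2 by rewrite ge_min lexx.
have md2 : Num.min (eta * m / 2) d' <= d' by rewrite ge_min lexx orbT.
have t0 := dist_gt0 pq.
(* The slope of [f'] at [(p, q)] exceeds [lip_norm f + eta - eta m]: half of the loss [eta m] comes
   from [(x, y)], half from [(p, q)]. As [f] contributes at most [lip_norm f], [h] has slope above
   [eta (1 - m)]. *)
have hpq : (1 - m) * `|p - q| < b p - b q.
  rewrite -ltr_pdivlMr // -(ltr_pM2l eta0).
  have -> : eta * ((b p - b q) / `|p - q|) = slope h p q.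
    by rewrite /slope /h; field; rewrite gt_eqF.
  have := slope_le_lip_norm f'lip xy; have := slope_le_lip_norm kf pq.
  by move: fpq fxy md1; rewrite /f' !slopeD hxy; lra.
have [bpq py] : b p - b q <= `|c - q| - `|c - p| /\ `|p - y| <= 4 * s.
  apply: bump_slope; apply: le_lt_trans hpq.
  by rewrite ler_pM2r //; lra.
have qy : `|q - y| <= 5 * s.
  have -> : q - y = (q - p) + (p - y) by rewrite addrA subrK.
  by apply: (le_trans (ler_normD _ _)); rewrite distrC; lra.
have L0 : 20 * (s / eta) <= `|c - q|.
  have : T - `|q - y| <= `|c - q|.
    have -> : c - q = T *: u - (q - y).
      by rewrite /c opprB addrA [T *: u + y]addrC.
    have -> : T = `|T *: u| by rewrite normrZ u1 mulr1 gtr0_norm.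
    by rewrite normrZ u1 mulr1 [`|_|](gtr0_norm T0) -{1}[T]mulr1 -u1
         -{1}(gtr0_norm T0) -normrZ lerB_dist.
  lra.
have cq : c != q by rewrite -subr_eq0 -normr_gt0; lra.
exists f', p, q; split=> //.
- by rewrite /f' /h !fctE subrr mulr0 addr0.
- lra.
- split; last first.
    have -> : p - x = (p - y) + (y - x) by rewrite addrA subrK.
    by apply: (le_trans (ler_normD _ _)); rewrite [`|y - x|]distrC -/s; lra.
  have A : `|direction c q - direction p q| < eta / 2.
    apply: (cone_slope_direction uc) => //; apply: lt_le_trans bpq.
    by apply: le_lt_trans hpq; rewrite ler_pM2r //; lra.
  have B : `|direction c q - u| <= eta / 2.
    have := cone_direction (ltW T0) u1 cq; rewrite -/c => B.
    have L1 : 0 < `|c - q| by lra.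
    rewrite -(ler_pM2l L1); apply: (le_trans B).
    have : 20 * (s / eta) * (eta / 2) <= `|c - q| * (eta / 2).
      by rewrite ler_pM2r //; lra.
    have -> : 20 * (s / eta) * (eta / 2) = 10 * s by field; rewrite gt_eqF.
    lra.
  have -> : direction p q - direction x y =
      (direction p q - direction c q) + (direction c q - u).
    by rewrite addrA subrK.
  by apply: (le_trans (ler_normD _ _)); rewrite distrC; lra.
Qed.

End Perturbation.

(** * Limits of geometrically convergent sequences *)

Section GeometricSequences.
Context {R : realType}.

Lemma geometric_dist (V : normedModType R) (a : nat -> V) (C : R) :
  (forall n, `|a n.+1 - a n| <= C * 2^-1 ^+ n) ->
  forall n k, `|a n - a (n + k)%N| <= 2 * C * 2^-1 ^+ n.
Proof.
move=> aC n k.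
have half0 i : 0 <= (2^-1 : R) ^+ i by rewrite exprn_ge0 ?invr_ge0.
have C0 : 0 <= C by have := aC 0%N; rewrite expr0 mulr1; apply: le_trans.
(* The exact partial geometric sum makes the induction close. *)
suff : `|a n - a (n + k)%N| <= 2 * C * 2^-1 ^+ n * (1 - 2^-1 ^+ k).
  by move/le_trans; apply; rewrite ler_piMr ?mulr_ge0 ?gerBl.
elim: k => [|k IH]; first by rewrite addn0 subrr normr0 expr0 subrr mulr0.
have -> : a n - a (n + k.+1)%N =
    (a n - a (n + k)%N) + (a (n + k)%N - a (n + k).+1).
  by rewrite addrA subrK addnS.
apply: (le_trans (ler_normD _ _)).
have := aC (n + k)%N; rewrite distrC => H; apply: (le_trans (lerD IH H)).
by rewrite exprD exprSr le_eqVlt; apply/orP; left; apply/eqP; field.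
Qed.

Lemma geometric_cvg (V : completeNormedModType R) (a : nat -> V) (C : R) :
  (forall n, `|a n.+1 - a n| <= C * 2^-1 ^+ n) ->
  exists2 l, a n @[n --> \oo] --> l & forall n, `|a n - l| <= 2 * C * 2^-1 ^+ n.
Proof.
move=> /geometric_dist aC.
have : cvg (a n @[n --> \oo]).
  apply: cauchy_cvg; apply: cauchy_exP => e e0.
  have [N /(_ _ (leqnn N)) Ne] := half_expn_lt (2 * C) e0.
  exists (a N), N => // n /= Nn; rewrite -ball_normE /=.
  by apply: le_lt_trans Ne; rewrite -(subnKC Nn).
move=> acvg; exists (lim (a n @[n --> \oo])) => // n.
have : `|a n - a k| @[k --> \oo] --> `|a n - lim (a n @[n --> \oo])|.
  by apply: cvg_norm; apply: cvgB => //; apply: cvg_cst.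
move/cvgr_to_le; apply.
by exists n => // k /= nk; rewrite -(subnKC nk).
Qed.

Lemma cvg_geometric_dist (V : normedModType R) (a : nat -> V) l (C : R) :
  (forall n, `|a n - l| <= C * 2^-1 ^+ n) -> a n @[n --> \oo] --> l.
Proof.
move=> aC; apply/cvgrPdist_lt => e e0.
have [N CN] := half_expn_lt C e0.
by exists N => // n /= /CN; rewrite distrC; apply: le_lt_trans.
Qed.

End GeometricSequences.

(** Completeness of [Lip0] with a rate. The increments [F n z - F n w] converge geometrically with
    constant proportional to [|z - w|], so the pointwise limit is also a limit in Lipschitz norm;
    [w = 0] gives pointwise convergence. *)
Lemma lipschitz_limit (R : realType) (X : normedModType R)
    (F : nat -> X -> R) (c : R) :
  (forall n, F n 0 = 0) ->
  (forall n, lip_bound (c * 2^-1 ^+ n) (F n.+1 - F n)) ->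
  exists2 g : X -> R, g 0 = 0 &
    forall n, lip_bound (2 * c * 2^-1 ^+ n) (F n - g).
Proof.
move=> F0 FC.
have FCz z w n : `|(F n.+1 z - F n.+1 w) - (F n z - F n w)| <=
    c * `|z - w| * 2^-1 ^+ n.
  rewrite mulrAC; have := FC n z w; rewrite !fctE.
  suff -> : F n.+1 z - F n z - (F n.+1 w - F n w) =
            F n.+1 z - F n.+1 w - (F n z - F n w) by [].
  by ring.
have Fcvg z : exists l : R, F n z @[n --> \oo] --> l.
  have [|l Fl _] := @geometric_cvg R R (F ^~ z) (c * `|z - 0|);
    last by exists l.
  by move=> n; have := FCz z 0 n; rewrite !F0 !subr0.
have [g gF] := choice Fcvg.
exists g => [|n z w].
  have := gF 0; under eq_fun do rewrite F0; move/(cvg_unique _); apply => //.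
  exact: cvg_cst.
have [l Fl lC] := @geometric_cvg R R _ _ (FCz z w).
have lE : l = g z - g w by apply: cvg_unique Fl _ => //; apply: cvgB; apply: gF.
have := lC n; rewrite lE !fctE.
suff -> : F n z - F n w - (g z - g w) = F n z - g z - (F n w - g w).
  by move/le_trans; apply; rewrite le_eqVlt; apply/orP; left; apply/eqP; ring.
by ring.
Qed.

Lemma indexed_dependent_choice (S : Type) (P : nat -> S -> Prop)
    (Q : nat -> S -> S -> Prop) s0 :
  P 0%N s0 -> (forall n s, P n s -> exists s', P n.+1 s' /\ Q n s s') ->
  exists u : nat -> S, u 0%N = s0 /\ forall n, P n (u n) /\ Q n (u n) (u n.+1).
Proof.
move=> Ps0 step.
(* Putting the invariant inside the existential makes the step total, so that [choice] applies. *)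
have ex (ns : nat * S) :
    exists s', P ns.1 ns.2 -> P ns.1.+1 s' /\ Q ns.1 ns.2 s'.
  case: ns => n s; have [/step[s' ?]|nP] := pselect (P n s); first by exists s'.
  by exists s.
have [F FP] := choice ex.
pose u := fix u n := if n is m.+1 then F (m, u m) else s0.
have Pu n : P n (u n) by elim: n => // n /(FP (n, _))[].
by exists u; split=> // n; split=> //; have [] := FP (n, u n) (Pu n).
Qed.

(** * Iterating the perturbation *)

Section Iteration.
Context {R : realType} {X : normedModType R}.

Lemma slope_dist (f g : X -> R) k x y : lip_bound k (f - g) -> x != y ->
  `|slope f x y - slope g x y| <= k.
Proof.
move=> kfg xy; have xy0 := dist_gt0 xy.
rewrite -mulrBl normrM normfV normr_id ler_pdivrMr //.
have := kfg x y; rewrite !fctE.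
by have -> : f x - f y - (g x - g y) = f x - g x - (f y - g y) by ring.
Qed.

Lemma iterated_perturbation (c : R) : uniformly_convex X -> 0 < c ->
  exists2 d : R, 0 < d & forall (f : X -> R) (k : R) x y,
    f 0 = 0 -> 0 <= k -> lip_bound k f ->
    x != y -> lip_norm f - d < slope f x y ->
    exists (F : nat -> X -> R) (a b : nat -> X),
      [/\ F 0%N = f, segment x y (a 0%N) &
          direction (a 0%N) (b 0%N) = direction x y] /\
      forall n,
      [/\ F n 0 = 0 /\ a n != b n,
          exists2 l, 0 <= l & lip_bound l (F n),
          `|a n - b n| <= c * 2^-1 ^+ n,
          lip_norm (F n) - c * 2^-1 ^+ n < slope (F n) (a n) (b n) &
          [/\ lip_bound (c * 2^-1 ^+ n) (F n.+1 - F n),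
              `|a n.+1 - a n| <= 5 * c * 2^-1 ^+ n &
              `|direction (a n.+1) (b n.+1) - direction (a n) (b n)| <=
                c * 2^-1 ^+ n]].
Proof.
move=> ucX c0; pose eta n := c * 2^-1 ^+ n.
have eta0 n : 0 < eta n by rewrite mulr_gt0 // exprn_gt0 // invr_gt0.
have [dl dlP] := choice (fun n => perturbation ucX (eta0 n)).
exists (dl 0%N); first by have [] := dlP 0%N.
move=> f k x y f0 k0 kf xy fxy.
(* A step moves the point by up to 5 times the length of the pair, so the possibly long pair
   [(x, y)] is first shortened inside its segment. *)
have [a0 [b0 [a0in ab0 ab0r ab0d ab0f]]] := shrink_pair f xy (eta0 0%N).
pose P n (s : (X -> R) * X * X) := let: (g, a, b) := s in
  [/\ g 0 = 0, exists2 l, 0 <= l & lip_bound l g, a != b, `|a - b| <= eta n &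
      lip_norm g - dl n < slope g a b].
pose Q n (s s' : (X -> R) * X * X) :=
  let: (g, a, b) := s in let: (g', a', b') := s' in
  [/\ lip_bound (eta n) (g' - g), `|a' - a| <= 5 * eta n &
      `|direction a' b' - direction a b| <= eta n].
have P0 : P 0%N (f, a0, b0).
  by split=> //; [exists k|exact: ltW|exact: lt_le_trans ab0f].
have step n s : P n s -> exists s', P n.+1 s' /\ Q n s s'.
  case: s => -[g a] b [g0 [l l0 lg] ab abn gab].
  (* Asking for the tolerance and length of index [n.+1] makes the new pair admissible for the next
     step. *)
  have [_ _ /(_ g l l0 lg a b ab gab (dl n.+1) (eta n.+1))] := dlP n.
  have [dl0 _ _] := dlP n.+1; move=> /(_ dl0 (eta0 _)).
  move=> [g' [a' [b' [g'0 g'g [ab' ab'n] g'ab [dab aa]]]]].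
  exists (g', a', b'); split; last first.
    by split=> //; apply: le_trans aa _; rewrite ler_pM2l.
  split=> //; [by rewrite g'0 | | exact: ltW].
  exists (l + eta n); first by rewrite addr_ge0 // ltW.
  suff -> : g' = g + (g' - g) by apply: lip_boundD.
  by apply/funext => z; rewrite !fctE addrC subrK.
have [u [u0 uP]] := indexed_dependent_choice P0 step.
exists (fun n => (u n).1.1), (fun n => (u n).1.2), (fun n => (u n).2).
split=> [|n]; first by rewrite u0.
have [_ dle _] := dlP n.
have := uP n; case: (u n) => -[g a] b; case: (u n.+1) => -[g' a'] b' /=.
move=> [[g0 lg ab abn gab] [gg aa dd]].
split=> //; last by split=> //; rewrite -mulrA.
by apply: le_lt_trans gab; rewrite lerD2l lerN2.
Qed.

End Iteration.

(** * Normalising the limit and the final estimates *)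

Lemma dist_le (R : realType) (X : normedModType R) (v p : X) (A : set X) :
  A p -> dist v A <= `|v - p|.
Proof.
move=> Ap; apply: ge_inf; last by exists p.
by exists 0 => _ [q _ <-].
Qed.

Theorem theorem5p3 (R : realType) (X : completeNormedModType R)
    (hX : uniformly_convex X) : local_directional_BPB X.
Proof.
move=> e e0.
(* The largest final error is [10 c], from [a 0] to [v]; [16 c <= 1] keeps the norm of the limit at
   least 7/8. *)
have [c [c0 ce c1]] : exists c : R, [/\ 0 < c, 16 * c <= e & 16 * c <= 1].
  exists (Num.min e 1 / 16); rewrite divr_gt0 ?lt_min ?e0 //=.
  by rewrite mulrC divfK // !ge_min !lexx orbT.
have [d d0 dP] := iterated_perturbation hX c0; exists d => //.
move=> f [/lipschitzP[k0 k0f] f0] f1 x y xy fxy.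
have f1b : lip_bound 1 f by rewrite -f1; apply: lip_norm_bound k0f.
rewrite -[in X in X - d]f1 in fxy.
have [F [a [b [[F0 a0 d0E] FP]]]] := dP f 1 x y f0 ler01 f1b xy fxy.
have ab n : a n != b n by have [[]] := FP n.
have [g0 g00 Fg0] : exists2 g : X -> R, g 0 = 0 &
    forall n, lip_bound (2 * c * 2^-1 ^+ n) (F n - g).
  by apply: lipschitz_limit => n; have [[? _] _ _ _ []] := FP n.
have [v av vn] : exists2 v, a n @[n --> \oo] --> v &
    forall n, `|a n - v| <= 2 * (5 * c) * 2^-1 ^+ n.
  by apply: geometric_cvg => n; have [_ _ _ _ []] := FP n.
have [u du un] : exists2 u, direction (a n) (b n) @[n --> \oo] --> u &
    forall n, `|direction (a n) (b n) - u| <= 2 * c * 2^-1 ^+ n.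
  by apply: geometric_cvg => n; have [_ _ _ _ []] := FP n.
have fg0 : lip_bound (2 * c) (f - g0).
  by have := Fg0 0%N; rewrite F0 expr0 mulr1.
have g0f : lip_bound (2 * c) (g0 - f) by apply: lip_boundN.
pose N := lip_norm g0.
have g0lip : lip_bound (1 + 2 * c) g0.
  have -> : g0 = f + (g0 - f) by apply/funext => z; rewrite !fctE addrC subrK.
  exact: lip_boundD.
have c20 : 0 <= 2 * c by lra.
have N1 : `|N - 1| <= 2 * c.
  rewrite ler_norml.
  have := lip_norm_leB ler01 c20 f1b g0f.
  have := lip_norm_leB (addr_ge0 ler01 c20) c20 g0lip fg0.
  by rewrite f1 -/N => ? ?; apply/andP; split; lra.
have N0 : 7 / 8 <= N by move: N1; rewrite ler_norml => /andP[? ?]; lra.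
have Npos : 0 < N by lra.
pose g z := N^-1 * g0 z.
have glip : lip_bound 1 g.
  have := lip_boundZ (N^-1) (lip_norm_bound g0lip).
  by rewrite gtr0_norm ?invr_gt0 // mulVf // gt_eqF.
have slg : slope g (a n) (b n) @[n --> \oo] --> (1 : R).
  (* In units of [c / 2^n]: 2 from the slopes of [F n] and [g0], 1 from near optimality, 2 from
     their norms. *)
  apply: (@cvg_geometric_dist _ R _ _ (N^-1 * (5 * c))) => n.
  have [_ [l l0 lF] _ sl _] := FP n.
  have -> : slope g (a n) (b n) - 1 = N^-1 * (slope g0 (a n) (b n) - N).
    by rewrite /slope /g; field; rewrite !gt_eqF // dist_gt0.
  rewrite normrM gtr0_norm ?invr_gt0 // -mulrA ler_pM2l ?invr_gt0 //.
  have e20 : 0 <= 2 * c * 2^-1 ^+ n.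
    by rewrite mulr_ge0 // exprn_ge0 // invr_ge0.
  have H1 := slope_dist (Fg0 n) (ab n).
  have H2 := slope_le_lip_norm g0lip (ab n).
  have H3 := lip_norm_leB l0 e20 lF (lip_boundN (Fg0 n)).
  move: H1; rewrite !ler_norml => /andP[H4 H5].
  have : 0 <= c * 2^-1 ^+ n.
    by rewrite mulr_ge0 // ?ltW // exprn_ge0 // invr_ge0.
  move: H3 H4 H5 H2 sl e20; rewrite -/N -!mulrA.
  by set t := c * _ => ? ? ? ? ? ? ?; apply/andP; split; lra.
(* Slopes of [g] are at most [lip_norm g] and tend to 1. *)
have gN : lip_norm g = 1.
  apply/eqP; rewrite eq_le lip_norm_le //=.
  apply: (cvgr_to_le slg); apply: nearW => n.
  exact: slope_le_lip_norm glip (ab n).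
exists g, v, u; split.
- split=> //; split; first by apply/lipschitzP; exists 1.
  by rewrite /g g00 mulr0.
- split; rewrite /unit_sphere /=.
    have nu : `|direction (a n) (b n)| @[n --> \oo] --> `|u| by apply: cvg_norm.
    have n1 : (fun n => `|direction (a n) (b n)|) = cst 1.
      by apply/funext => n; rewrite direction_norm.
    by rewrite n1 in nu; apply: cvg_unique nu _ => //; apply: cvg_cst.
  exists a, b; split=> //; last by rewrite gN.
  split=> //; apply: (@cvg_geometric_dist _ _ _ _ (11 * c)) => n.
  have [_ _ abn _ _] := FP n; have vn' := vn n.
  have -> : b n - v = (b n - a n) + (a n - v) by rewrite addrA subrK.
  apply: (le_trans (ler_normD _ _)); rewrite distrC.
  by move: abn vn'; rewrite -!mulrA; lra.
- apply: (@le_lt_trans _ _ (4 * c)); last by lra.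
  apply: lip_norm_le; first by lra.
  (* The normalisation costs [|1/N - 1| N = |1 - N| <= 2 c], the limit another [2 c]. *)
  have -> : g - f = (fun z => (N^-1 - 1) * g0 z) + (g0 - f).
    by apply/funext => z; rewrite /g !fctE; ring.
  have -> : 4 * c = 2 * c + 2 * c by ring.
  apply: lip_boundD => // p q.
  apply: (le_trans (lip_boundZ (N^-1 - 1) (lip_norm_bound g0lip) p q)).
  rewrite ler_wpM2r // -/N -{2}(gtr0_norm Npos) -normrM mulrBl mulVf ?gt_eqF //.
  by rewrite mul1r distrC.
- have := un 0%N; rewrite d0E expr0 mulr1 => /le_lt_trans; apply; lra.
- apply: le_lt_trans (dist_le _ a0) _; rewrite distrC.
  by have := vn 0%N; rewrite expr0 mulr1 => /le_lt_trans; apply; lra.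
Qed.
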